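(* Let $P$ be an $n\times n$ irreducible stochastic matrix with stationary distribution vector $\boldsymbol{\pi}$, partitioned as $P=\begin{bmatrix}P_{11}&P_{12}\\P_{21}&P_{22}\end{bmatrix}$ with $P_{11}$ of size $m\times m$ and $P_{22}$ of size $(n-m)\times(n-m)$, $1\le m\le n-1$. Let $P_1=P_{11}+P_{12}(I-P_{22})^{-1}P_{21}$, $P_2=P_{22}+P_{21}(I-P_{11})^{-1}P_{12}$, partition $\boldsymbol{\pi}^T=[\boldsymbol{\pi}_1^T\ \boldsymbol{\pi}_2^T]$ conformally, and let $\gamma=\kappa(P)-\kappa(P_1)-\kappa(P_2)$. Then $$|\gamma|\le2\,\|(I-P+\mathbf{1}\boldsymbol{\pi}^T)^{-1}\|_\infty\,\max(\|\boldsymbol{\pi}_1\|,1-\|\boldsymbol{\pi}_1\|).$$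
   Context: A square nonnegative matrix $P$ is stochastic if $P\mathbf{1}=\mathbf{1}$, where $\mathbf{1}$ is the all-ones vector of appropriate size. The stationary distribution vector of an irreducible stochastic $P$ is the unique vector $\boldsymbol{\pi}$ with $\boldsymbol{\pi}^TP=\boldsymbol{\pi}^T$, $\boldsymbol{\pi}^T\mathbf{1}=1$. For vectors, $\|\cdot\|$ is the 1-norm; for matrices, $\|\cdot\|_\infty$ is the norm induced by the vector infinity norm (maximum absolute row sum). Since $P$ is irreducible, $I-P_{11}$ and $I-P_{22}$ are nonsingular, and the stochastic complements $P_1,P_2$ are stochastic and irreducible. Kemeny's constant of an irreducible stochastic $N\times N$ matrix $Q$ with eigenvalues $\lambda_1=1,\lambda_2,\dots,\lambda_N$ (with algebraic multiplicity) is $\kappa(Q)=\sum_{i=2}^N\frac{1}{1-\lambda_i}$; equivalently $\kappa(Q)=\operatorname{Tr}\big((I-Q+\mathbf{1}\mathbf{h}^T)^{-1}\big)-1$ for any $\mathbf{h}$ with $\mathbf{h}^T\mathbf{1}=1$. *)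

(* Defs.v *)
From mathcomp Require Import all_boot all_order all_algebra perm complex.

Set Implicit Arguments.
Unset Strict Implicit.
Unset Printing Implicit Defensive.

Import Order.TTheory GRing.Theory Num.Theory.
Local Open Scope ring_scope.

Definition ones (R : rcfType) (N : nat) : 'cV[R]_N := const_mx 1.

Definition stochastic (R : rcfType) (N : nat) (P : 'M[R]_N) : Prop :=
  (forall i j, 0 <= P i j) /\ P *m ones R N = ones R N.

(* [A] is reducible when some simultaneous permutation of its rows and columns
   gives [[B, C], [0, D]] with [B] square of size [r] and [0 < r < N]. *)
Definition reducible (R : rcfType) (N : nat) (A : 'M[R]_N) : Prop :=
  exists (s : 'S_N) (r : nat), (0 < r < N)%N /\
    forall i j : 'I_N, (r <= i)%N -> (j < r)%N -> A (s i) (s j) = 0.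

Definition irreducible (R : rcfType) (N : nat) (A : 'M[R]_N) : Prop :=
  ~ reducible A.

Definition stationary (R : rcfType) (N : nat) (P : 'M[R]_N) (pi : 'cV[R]_N) :
    Prop :=
  pi^T *m P = pi^T /\ pi^T *m ones R N = 1%:M.

Definition vec_norm1 (R : rcfType) (N : nat) (v : 'cV[R]_N) : R :=
  \sum_i `|v i 0|.

Definition mx_norm_inf (R : rcfType) (M N : nat) (A : 'M[R]_(M, N)) : R :=
  \big[Num.max/0]_i \sum_j `|A i j|.

(* The complex eigenvalues of the real matrix [Q], listed with algebraic
   multiplicity, in an unspecified order. *)
Definition eigenvalues (R : rcfType) (N : nat) (Q : 'M[R]_N) : seq R[i] :=
  sval (closed_field_poly_normal (char_poly (map_mx (real_complex R) Q))).

Lemma char_poly_eigenvalues (R : rcfType) (N : nat) (Q : 'M[R]_N) :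
  char_poly (map_mx (real_complex R) Q)
  = \prod_(z <- eigenvalues Q) ('X - z%:P).
Proof.
rewrite /eigenvalues; case: closed_field_poly_normal => s /= Es.
by rewrite {1}Es (monicP (char_poly_monic _)) scale1r.
Qed.

(* [rem] deletes a single occurrence of the eigenvalue 1. The sum is kept in
   [R[i]], although its value is real. *)
Definition kemeny (R : rcfType) (N : nat) (Q : 'M[R]_N) : R[i] :=
  \sum_(z <- rem 1 (eigenvalues Q)) 1 / (1 - z).

Definition stoch_compl1 (R : rcfType) (m k : nat) (P : 'M[R]_(m + k)) :
    'M[R]_m :=
  ulsubmx P + ursubmx P *m invmx (1%:M - drsubmx P) *m dlsubmx P.

Definition stoch_compl2 (R : rcfType) (m k : nat) (P : 'M[R]_(m + k)) :
    'M[R]_k :=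
  drsubmx P + dlsubmx P *m invmx (1%:M - ulsubmx P) *m ursubmx P.

(* Main.v *)
Require Import Defs.
From mathcomp Require Import all_boot all_order all_algebra perm complex.
From mathcomp Require Import zify ring lra.

Set Implicit Arguments.
Unset Strict Implicit.
Unset Printing Implicit Defensive.

Import Order.TTheory GRing.Theory Num.Theory.
Local Open Scope ring_scope.

(** Let [Z] be the inverse of [I - P + 1 pi^T], with diagonal blocks [Z11] and
    [Z22]. Then [kemeny P = \tr Z - 1], and since [Z11] is a generalised inverse
    of [I - P_1], [kemeny P_1 = \tr Z11 - a] where [a = pi1^T Z11 1 / pi1^T 1];
    likewise [kemeny P_2 = \tr Z22 - b]. Hence [gamma = a + b - 1], which is
    the nontrivial eigenvalue of the 2 x 2 matrix [[a, 1 - a], [1 - b, b]]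
    obtained by averaging the blocks of [Z] with the positive weights [pi].
    This matrix has infinity norm at most that of [Z], so [|gamma|] is at most
    the norm of [Z]; finally [2 max (t, 1 - t) >= 1]. *)

(** * Characteristic polynomials and the trace formula for Kemeny's constant *)

(** The points [a + 1], [a + 2], ... are distinct and differ from [a], so a nonzero [p - q] would
    have as many roots as its size. *)
Lemma poly_eq_except (F : numFieldType) (a : F) (p q : {poly F}) :
  (forall x, x != a -> p.[x] = q.[x]) -> p = q.
Proof.
move=> pq; apply/eqP; rewrite -subr_eq0; apply: contraT => r0.
pose s := [seq a + i.+1%:R | i <- iota 0 (size (p - q))].
have := @max_poly_roots _ _ s r0; rewrite size_map size_iota ltnn => -> //.
  apply/allP=> x /mapP[i _ ->]; rewrite rootE !hornerE pq ?subrr //.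
  by rewrite -subr_eq0 addrC addKr pnatr_eq0.
rewrite map_inj_uniq ?iota_uniq // => i j /addrI /eqP.
by rewrite eqr_nat eqSS => /eqP.
Qed.

(** Both sides of [E] factor the block matrix [[[1, - v], [u, 1]]] into block triangular
    matrices. *)
Lemma det_add_rank1 (F : fieldType) (n : nat) (u : 'cV[F]_n) (v : 'rV[F]_n) :
  \det (1%:M + u *m v) = 1 + (v *m u) 0 0.
Proof.
have E : block_mx 1%:M 0 u 1%:M *m block_mx 1%:M (- v) 0 (1%:M + u *m v)
    = block_mx (1%:M + v *m u) (- v) 0 1%:M *m block_mx 1%:M 0 u 1%:M.
  rewrite !mulmx_block !mul1mx !mul0mx !mulmx1 !mulmx0 !addr0 !add0r mulmxN.
  by rewrite mulNmx addrK addrC addrK.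
have := congr1 determinant E.
rewrite !det_mulmx !det_lblock !det_ublock !det1 !mul1r !mulr1 => ->.
by rewrite [1%:M + _]mx11_scalar det_scalar1 !mxE eqxx.
Qed.

Lemma horner_char_poly (F : comNzRingType) (n : nat) (A : 'M[F]_n) (x : F) :
  (char_poly A).[x] = \det (x%:M - A).
Proof.
rewrite /char_poly -horner_evalE -det_map_mx; congr determinant.
by apply/matrixP=> i j; rewrite !mxE /= /horner_eval !hornerE hornerMn hornerX.
Qed.

(** Subtracting [e *m h] moves one eigenvalue from 1 to 0. Away from [x = 1], [x - (M - e h)] is
    [x - M] times a rank-one update of the identity, of determinant [x / (x - 1)]. *)
Lemma char_poly_deflation (F : numFieldType) (n : nat) (M : 'M[F]_n)
    (e : 'cV[F]_n) (h : 'rV[F]_n) :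
  M *m e = e -> h *m e = 1%:M ->
  ('X - 1) * char_poly (M - e *m h) = 'X * char_poly M.
Proof.
move=> Me he; apply: (@poly_eq_except _ 1) => x x1.
have x10 : x - 1 != 0 by rewrite subr_eq0.
rewrite !hornerM !hornerE !horner_char_poly.
have -> : x%:M - (M - e *m h)
    = (x%:M - M) *m (1%:M + ((x - 1)^-1 *: e) *m h).
  rewrite mulmxDr mulmx1 -scalemxAl -scalemxAr mulmxA mulmxBl Me mul_scalar_mx.
  rewrite -{3}[e]scale1r -scalerBl -scalemxAl scalerA mulVf // scale1r.
  by rewrite opprB addrCA addrC.
rewrite det_mulmx det_add_rank1 -scalemxAr he !mxE eqxx mulr1.
by field.
Qed.

(** As [W] inverts [1 - M], its eigenvalues are the [(1 - z)^-1], and the trace is their sum. *)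
Lemma sum_inv_char_poly_roots (F : numFieldType) (n : nat) (M W : 'M[F]_n)
    (s : seq F) :
  char_poly M = \prod_(z <- s) ('X - z%:P) -> (1%:M - M) *m W = 1%:M ->
  \sum_(z <- s) (1 - z)^-1 = \tr W.
Proof.
move=> chi MW.
have sz : size s = n.
  by have := size_char_poly M; rewrite chi size_prod_XsubC => -[].
have hor x : \det (x%:M - M) = \prod_(z <- s) (x - z).
  rewrite -horner_char_poly chi horner_prod.
  by apply: eq_bigr => z _; rewrite !hornerE.
have d0 : \prod_(z <- s) (1 - z) != 0.
  rewrite -hor; apply: contraTneq isT => d0.
  have := congr1 determinant MW; rewrite det_mulmx d0 mul0r det1.
  by move/eqP; rewrite eq_sym oner_eq0.
have z1 z : z \in s -> 1 - z != 0.
  by move: d0; rewrite prodf_seq_neq0 => /allP + zs; move/(_ z zs).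
have chiW : char_poly W = \prod_(z <- [seq (1 - z)^-1 | z <- s]) ('X - z%:P).
  apply: (@poly_eq_except _ 0) => x x0.
  rewrite horner_char_poly big_map horner_prod; apply: (mulfI d0).
  rewrite -{1}hor -det_mulmx mulmxBr MW mul_mx_scalar.
  have -> : x *: (1%:M - M) - 1%:M = x *: ((1 - x^-1)%:M - M).
    rewrite !scalerBr !scale_scalar_mx mulrBr !mulr1 divff // [in RHS]raddfB /=.
    by rewrite addrAC.
  rewrite detZ hor -{1}sz -big_split /= => {chi sz hor d0}.
  elim: s z1 => [|z s IHs] z1; first by rewrite !big_nil mulr1.
  rewrite !big_cons exprS mulrACA IHs => [|y ys].
    by congr (_ * _); rewrite !hornerE; field; rewrite x0 z1 ?mem_head.
  by apply: z1; rewrite inE ys orbT.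
(* The trace is read off the coefficient of index [n - 1], so the empty matrix is treated apart. *)
case: n M W chi MW sz hor chiW => [|n] M W chi MW sz hor chiW.
  by rewrite (size0nil sz) big_nil /mxtrace big_ord0.
apply: oppr_inj; rewrite -char_poly_trace // chiW.
have {1}-> : n.+1.-1 = (size [seq (1 - z)^-1 | z <- s]).-1 by rewrite size_map sz.
by rewrite coefPn_prod_XsubC ?size_map ?sz // big_map.
Qed.

(** Deflation trades one eigenvalue 1 for 0, whose term [(1 - 0)^-1] accounts for the [- 1]. *)
Lemma sum_inv_nontrivial_roots (F : numFieldType) (n : nat) (Q W : 'M[F]_n)
    (e : 'cV[F]_n) (h : 'rV[F]_n) (s : seq F) :
  Q *m e = e -> h *m e = 1%:M -> (1%:M - Q + e *m h) *m W = 1%:M ->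
  char_poly Q = \prod_(z <- s) ('X - z%:P) ->
  \sum_(z <- rem 1 s) (1 - z)^-1 = \tr W - 1.
Proof.
move=> Qe he QW chiQ.
have E := char_poly_deflation Qe he.
have s1 : 1 \in s.
  rewrite -root_prod_XsubC -chiQ rootE.
  by have := congr1 (horner^~ 1) E; rewrite !hornerE subrr mul0r => /esym/eqP.
have X1 : 'X - 1 != 0 :> {poly F} by rewrite -[1]/(1%:P) polyXsubC_eq0.
have chi : char_poly (Q - e *m h) = \prod_(z <- 0 :: rem 1 s) ('X - z%:P).
  apply: (mulfI X1); rewrite E chiQ (perm_big _ (perm_to_rem s1)) !big_cons.
  by rewrite subr0 mulrCA.
have MW : (1%:M - (Q - e *m h)) *m W = 1%:M by rewrite opprB addrA addrAC.
rewrite -(sum_inv_char_poly_roots chi MW) big_cons subr0 invr1.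
by rewrite [1 + _]addrC addrK.
Qed.

Lemma kemeny_trace (R : rcfType) (n : nat) (Q W : 'M[R]_n)
    (e : 'cV[R]_n) (h : 'rV[R]_n) :
  Q *m e = e -> h *m e = 1%:M -> (1%:M - Q + e *m h) *m W = 1%:M ->
  kemeny Q = real_complex R (\tr W - 1).
Proof.
move=> Qe he QW; pose f := real_complex R.
have fe : map_mx f Q *m map_mx f e = map_mx f e by rewrite -map_mxM Qe.
have fhe : map_mx f h *m map_mx f e = 1%:M by rewrite -map_mxM he map_mx1.
have fQW : (1%:M - map_mx f Q + map_mx f e *m map_mx f h) *m map_mx f W = 1%:M.
  by rewrite -[RHS](map_mx1 f) -QW map_mxM map_mxD map_mxB map_mx1 map_mxM.
rewrite rmorphB rmorph1 -trace_map_mx.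
rewrite -(sum_inv_nontrivial_roots fe fhe fQW (char_poly_eigenvalues Q)).
by apply: eq_bigr => z _; rewrite div1r.
Qed.

(** * Irreducibility, the maximum principle and positivity of the stationary vector *)

Lemma unitmx_inj (F : fieldType) (n : nat) (A : 'M[F]_n) :
  (forall x : 'cV_n, A *m x = 0 -> x = 0) -> A \in unitmx.
Proof.
move=> A0; rewrite -unitmx_tr unitmxE unitfE; apply/det0P => -[v v0 vA].
case/eqP: v0; apply: trmx_inj; rewrite trmx0; apply: A0.
by rewrite -[A]trmxK -trmx_mul vA trmx0.
Qed.

Lemma irreducible_closed (R : rcfType) (N : nat) (P : 'M[R]_N)
    (A : {set 'I_N}) (i0 : 'I_N) :
  irreducible P -> i0 \in A ->
  (forall i j, i \in A -> j \notin A -> P i j = 0) -> A = setT.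
Proof.
move=> irrP Ai0 PA0; apply/eqP; apply: contraT => AT; case: irrP.
(* Listing the complement of [A] first puts the zero entries, with rows in [A] and columns outside,
   in the lower left block. *)
pose L := enum (~: A) ++ enum A.
have cA : (#|A| + #|~: A|)%N = N by rewrite cardsC card_ord.
have sL : size L = N by rewrite size_cat -!cardE addnC.
have uL : uniq L.
  rewrite cat_uniq !enum_uniq andbT /=; apply/hasPn => x.
  by rewrite /= !mem_enum inE => ->.
have f_inj : injective (fun i : 'I_N => nth i0 L i).
  move=> i j /eqP; rewrite nth_uniq ?sL ?ltn_ord // => /eqP.
  exact: val_inj.
exists (perm f_inj), #|~: A|; split.
  suff : (0 < #|~: A|)%N && (0 < #|A|)%N by lia.
  rewrite !card_gt0.
   apply/andP; split; last by apply/set0Pn; exists i0.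
  by rewrite -setCT (inj_eq (@setC_inj _)).
move=> i j ri jr; rewrite !permE !nth_cat -cardE ltnNge ri jr /=.
apply: PA0.
  rewrite -mem_enum mem_nth // -cardE ltn_subLR // addnC cA.
  exact: ltn_ord.
by rewrite -in_setC -mem_enum mem_nth // -cardE.
Qed.

Lemma stochastic_row_sum (R : rcfType) (N : nat) (P : 'M[R]_N) i :
  stochastic P -> \sum_j P i j = 1.
Proof.
case=> _ /matrixP/(_ i 0); rewrite !mxE => <-.
by apply: eq_bigr => j _; rewrite mxE mulr1.
Qed.

(** At a maximiser, [P *m x] averages values that do not exceed the maximum, so every [j] with
    [P i j] nonzero is a maximiser too: the set of maximisers is closed. *)
Lemma subharmonic_const (R : rcfType) (N : nat) (P : 'M[R]_N) (x : 'cV[R]_N) :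
  stochastic P -> irreducible P ->
  (forall i, x i 0 <= (P *m x) i 0) -> forall i j, x i 0 = x j 0.
Proof.
move=> Ps Pi xP i0 j0.
case: (@arg_maxP _ _ _ i0 predT (fun i => x i 0) isT) => m _ xm.
have E : [set i | x i 0 == x m 0] = setT.
  apply: (irreducible_closed (i0 := m) Pi); rewrite ?inE // => i j.
  rewrite !inE => /eqP xi xj.
  have T0 l : 0 <= P i l * (x m 0 - x l 0).
    by apply: mulr_ge0; [exact: (proj1 Ps) | rewrite subr_ge0; exact: xm].
  have S0 : \sum_l P i l * (x m 0 - x l 0) = 0.
    apply: le_anti; rewrite sumr_ge0 // andbT.
    under eq_bigr do rewrite mulrBr.
    rewrite sumrB -mulr_suml (stochastic_row_sum _ Ps) mul1r subr_le0 -xi.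
    by have := xP i; rewrite mxE.
  have /eqP := psumr_eq0P (fun l _ => T0 l) S0 (i := j) isT.
  by rewrite mulf_eq0 subr_eq0 [x m 0 == _]eq_sym (negPf xj) orbF => /eqP.
have H i : x i 0 = x m 0.
  by have := in_setT i; rewrite -E inE => /eqP.
by rewrite !H.
Qed.

(* The maximum principle for [|x|]; the support of [x] plays the role of a proper diagonal block. *)
Lemma harmonic_on_support_eq0 (R : rcfType) (N : nat) (P : 'M[R]_N)
    (x : 'cV[R]_N) (j : 'I_N) :
  stochastic P -> irreducible P -> x j 0 = 0 ->
  (forall i, x i 0 != 0 -> (P *m x) i 0 = x i 0) -> x = 0.
Proof.
move=> Ps Pi xj xP.
pose y : 'cV[R]_N := \col_i `|x i 0|.
have yP i : y i 0 <= (P *m y) i 0.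
  have y0 : 0 <= (P *m y) i 0.
    by rewrite mxE sumr_ge0 // => l _; rewrite mxE mulr_ge0 ?(proj1 Ps).
  rewrite mxE; have [->|xi] := eqVneq (x i 0) 0; first by rewrite normr0.
  rewrite -xP // !mxE; apply: le_trans (ler_norm_sum _ _ _) _.
  by apply: ler_sum => l _; rewrite normrM mxE ger0_norm // (proj1 Ps).
apply/colP=> i; have := subharmonic_const Ps Pi yP i j.
by rewrite !mxE xj normr0 => /eqP; rewrite normr_eq0 => /eqP.
Qed.

(** The support of [v] is closed: if [v 0 b = 0], all terms [v 0 l * P l b] vanish. It is therefore
    empty or everything, and [i] lies outside it. *)
Lemma left_fixed_ge0_eq0 (R : rcfType) (N : nat) (P : 'M[R]_N)
    (v : 'rV[R]_N) (i : 'I_N) :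
  stochastic P -> irreducible P -> (forall j, 0 <= v 0 j) -> v *m P = v ->
  v 0 i = 0 -> v = 0.
Proof.
move=> Ps Pi v0 vP vi.
have E : [set j | v 0 j != 0] = set0.
  apply/eqP; apply: contraT => /set0Pn[j Aj].
  suff /setP/(_ i) : [set j | v 0 j != 0] = setT by rewrite !inE vi eqxx.
  apply: (irreducible_closed Pi Aj) => a b; rewrite !inE negbK => va /eqP vb.
  have : \sum_l v 0 l * P l b = v 0 b by rewrite -[in RHS]vP [RHS]mxE.
  rewrite vb => /(psumr_eq0P (fun l _ => mulr_ge0 (v0 l) (proj1 Ps l b)))/(_ a isT)/eqP.
  by rewrite mulf_eq0 (negPf va) => /eqP.
apply/rowP=> j; have := in_set0 j; rewrite -E inE mxE.
by move/negbFE/eqP.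
Qed.

(** The vector [w] of absolute values satisfies [w <= w P] with equal totals, so it is fixed as
    well. If [pi i 0 <= 0], the nonnegative fixed vector [w + v] vanishes at [i], hence everywhere,
    and [pi] could not sum to 1. *)
Lemma stationary_gt0 (R : rcfType) (N : nat) (P : 'M[R]_N) (pi : 'cV[R]_N) i :
  stochastic P -> irreducible P -> stationary P pi -> 0 < pi i 0.
Proof.
move=> Ps Pi [piP pi1]; pose v := pi^T.
pose w : 'rV[R]_N := \row_j `|v 0 j|.
have wle j : w 0 j <= (w *m P) 0 j.
  rewrite /w mxE {1}/v -piP !mxE; apply: le_trans (ler_norm_sum _ _ _) _.
  by apply: ler_sum => l _; rewrite normrM !mxE (ger0_norm (proj1 Ps _ _)).
have ws : \sum_j ((w *m P) 0 j - w 0 j) = 0.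
  have sE (u : 'rV[R]_N) : \sum_j u 0 j = (u *m ones R N) 0 0.
    by rewrite mxE; apply: eq_bigr => j _; rewrite mxE mulr1.
  by rewrite sumrB !sE -mulmxA (proj2 Ps) subrr.
have wP : w *m P = w.
  apply/rowP=> j; apply/eqP; rewrite -subr_eq0; apply/eqP.
  by apply: (psumr_eq0P _ ws) => // l _; rewrite subr_ge0.
rewrite ltNge; apply/negP=> vi.
have /rowP wv : w + v = 0.
  apply: (left_fixed_ge0_eq0 (i := i) Ps Pi); last by rewrite !mxE ler0_norm // addNr.
    by move=> j; rewrite !mxE -lerBlDr sub0r -normrN ler_norm.
  by rewrite mulmxDl wP piP.
have /matrixP/(_ 0 0) := pi1; rewrite !mxE eqxx mulr1n => /eqP; apply/negP.
rewrite lt_eqF // (le_lt_trans _ ltr01) // -oppr_ge0 -sumrN sumr_ge0 // => j _.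
have := wv j; rewrite !mxE mulr1 => /eqP.
by rewrite addr_eq0 => /eqP <-.
Qed.

(** * Kemeny's constant of a stochastic complement *)

(* [Z1] is a generalised inverse of the Schur complement [I - Q], so that
   [(I - E) Z1 (I - E) + E], with [E = 1 v / (v 1)], inverts [I - Q + E]. *)
Lemma kemeny_schur_complement (R : rcfType) (m k : nat) (A : 'M[R]_m)
    (B : 'M[R]_(m, k)) (C : 'M[R]_(k, m)) (D : 'M[R]_k) (Z1 : 'M[R]_m)
    (Z3 : 'M[R]_(k, m)) (v : 'rV[R]_m) :
  A *m ones R m + B *m ones R k = ones R m ->
  C *m ones R m + D *m ones R k = ones R k ->
  1%:M - D \in unitmx ->
  (1%:M - A) *m Z1 - B *m Z3 = 1%:M - ones R m *m v ->
  (1%:M - D) *m Z3 - C *m Z1 = - (ones R k *m v) ->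
  (v *m ones R m) 0 0 != 0 ->
  kemeny (A + B *m invmx (1%:M - D) *m C)
  = real_complex R (\tr Z1 - (v *m Z1 *m ones R m) 0 0 / (v *m ones R m) 0 0).
Proof.
set e := ones R m; set e2 := ones R k; set K := invmx _; set s := (v *m e) 0 0.
move=> ABe CDe Du AZ DZ s0; set Q := A + _.
pose h := s^-1 *: v; pose E := e *m h.
have he : h *m e = 1%:M.
  by rewrite -scalemxAl [v *m e]mx11_scalar scale_scalar_mx mulVf.
have Ce : C *m e = (1%:M - D) *m e2 by rewrite mulmxBl mul1mx -[X in X - _]CDe addrK.
have Qe : Q *m e = e.
  by rewrite mulmxDl -!mulmxA Ce mulKmx.
have CZ : C *m Z1 = (1%:M - D) *m Z3 + e2 *m v.
  by rewrite -[e2 *m v]opprK -DZ opprB addrC subrK.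
(* Eliminating [Z3] leaves an error of the form column times [v], which [1%:M - E] kills from the
   right by [vE]. *)
have QZ : (1%:M - Q) *m Z1 = 1%:M - (e + B *m K *m e2) *m v.
  rewrite opprD addrA mulmxDl mulNmx -!mulmxA CZ mulmxDr mulKmx // mulmxDr opprD.
  by rewrite addrA AZ mulmxDl opprD addrA !mulmxA.
have vE : v *m (1%:M - E) = 0.
  rewrite mulmxBr mulmx1 mulmxA [v *m e]mx11_scalar -scalemxAr mul_scalar_mx.
  by rewrite scalerA mulVf // scale1r subrr.
have EE : E *m (1%:M - E) = 0.
  by rewrite -mulmxA -scalemxAl vE scaler0 mulmx0.
have QE : (1%:M - Q) *m E = 0 by rewrite mulmxA mulmxBl mul1mx Qe subrr mul0mx.
pose W := (1%:M - E) *m Z1 *m (1%:M - E) + E.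
have QW : (1%:M - Q + e *m h) *m W = 1%:M.
  have SW : (1%:M - Q) *m W = 1%:M - E.
    rewrite mulmxDr QE addr0 !mulmxA [(1%:M - Q) *m _]mulmxBr mulmx1 QE subr0 QZ.
    rewrite [LHS]mulmxBl mul1mx.
    by rewrite -[X in _ - X]mulmxA vE mulmx0 subr0.
  have EW : E *m W = E.
    rewrite mulmxDr (mulmxA E) (mulmxA E) EE !mul0mx add0r.
    by apply/eqP; rewrite eq_sym -subr_eq0 -{1}[E]mulmx1 -mulmxBr EE.
  by rewrite mulmxDl SW EW subrK.
rewrite (kemeny_trace Qe he QW); congr (real_complex R _).
have EI : (1%:M - E) *m (1%:M - E) = 1%:M - E.
  by rewrite mulmxBl mul1mx EE subr0.
rewrite mxtraceD mxtrace_mulC mulmxA EI mulmxBl mul1mx.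
have trE (X : 'M[R]_m) : \tr (E *m X) = (v *m X *m e) 0 0 / s.
  rewrite /E -mulmxA mxtrace_mulC /mxtrace big_ord1 -scalemxAl -scalemxAl mxE.
  by rewrite mulrC.
have -> : \tr E = 1 by rewrite -[E]mulmx1 trE mulmx1 divff.
by rewrite raddfB /= trE addrK.
Qed.

(** * Norm estimates for the averaged blocks *)

Lemma le_mx_norm_inf (R : rcfType) (M N : nat) (A : 'M[R]_(M, N)) i :
  \sum_j `|A i j| <= mx_norm_inf A.
Proof. exact: (le_bigmax _ (fun i => \sum_j `|A i j|)). Qed.

Lemma ler_norm_weighted_rows (R : rcfType) (n m k : nat) (w : 'rV[R]_n)
    (X : 'M[R]_(n, m)) (Y : 'M[R]_(n, k)) (z : R) :
  (forall i, 0 <= w 0 i) ->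
  (forall i, \sum_j `|X i j| + \sum_j `|Y i j| <= z) ->
  `|(w *m X *m ones R m) 0 0| + `|(w *m Y *m ones R k) 0 0|
    <= (w *m ones R n) 0 0 * z.
Proof.
move=> w0 XYz.
have bound p (T : 'M[R]_(n, p)) :
    `|(w *m T *m ones R p) 0 0| <= \sum_i w 0 i * \sum_j `|T i j|.
  rewrite -mulmxA mxE; apply: le_trans (ler_norm_sum _ _ _) _.
  apply: ler_sum => i _; rewrite normrM ger0_norm // ler_wpM2l // mxE.
  apply: le_trans (ler_norm_sum _ _ _) _.
  by apply: ler_sum => j _; rewrite mxE mulr1.
apply: le_trans (lerD (bound _ X) (bound _ Y)) _.
rewrite -big_split mxE mulr_suml; apply: ler_sum => i _ /=.
by rewrite -mulrDr mxE mulr1 ler_wpM2l.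
Qed.

(* [x / p] and [x / q] are the off-diagonal entries of the coupling matrix
   [[a / p, x / p], [x / q, b / q]], whose eigenvalues are 1 and the quantity
   bounded here. *)
Lemma coupling_eigenvalue_bound (R : realFieldType) (p q a b x z : R) :
  0 < p -> 0 < q -> a + x = p -> b + x = q ->
  `|a| + `|x| <= p * z -> `|x| + `|b| <= q * z -> `|a / p + b / q - 1| <= z.
Proof.
(* Eliminating the diagonal entry over the larger weight leaves two terms bounded by the row of the
   smaller weight. *)
have half (p' q' a' x' : R) : 0 < p' -> p' <= q' ->
    `|a'| + `|x'| <= p' * z -> `|a' / p' - x' / q'| <= z.
  move=> p0 pq ax; have q0 := lt_le_trans p0 pq.
  apply: le_trans (ler_normB _ _) _.
  rewrite !normrM !normfV (gtr0_norm p0) (gtr0_norm q0).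
  apply: (@le_trans _ _ ((`|a'| + `|x'|) / p')).
    by rewrite mulrDl lerD2l ler_wpM2l // lef_pV2.
  by rewrite ler_pdivrMr // mulrC.
move=> p0 q0 ap bq axz xbz; have [pq|qp] := leP p q.
  have -> : a / p + b / q - 1 = a / p - x / q.
    have -> : b = q - x by rewrite -bq addrK.
    by field; rewrite !gt_eqF.
  exact: half.
have -> : a / p + b / q - 1 = b / q - x / p.
  have -> : a = p - x by rewrite -ap addrK.
  by field; rewrite !gt_eqF.
by apply: half; rewrite ?(ltW qp) // addrC.
Qed.

(** * The fundamental matrix [Z] of the chain, its blocks and the final bound *)

Theorem mainTheorem10 (R : rcfType) (m k : nat) (hm : (0 < m)%N) (hk : (0 < k)%N)
    (P : 'M[R]_(m + k)) (pi : 'cV[R]_(m + k))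
    (hPs : stochastic P) (hPi : irreducible P) (hpi : stationary P pi) :
  let gamma : R[i] :=
    kemeny P - kemeny (stoch_compl1 P) - kemeny (stoch_compl2 P) in
  let pi1 : 'cV[R]_m := usubmx pi in
  `|gamma| <=
    real_complex R
      (2 * mx_norm_inf (invmx (1%:M - P + ones R (m + k) *m pi^T))
         * Num.max (vec_norm1 pi1) (1 - vec_norm1 pi1)).
Proof.
cbv zeta; set pi1 := usubmx pi.
set M := 1%:M - P + _; set Z := invmx M; set z := mx_norm_inf Z.
have [piP pie] := hpi; have [P0 Pe] := hPs.
pose e := ones R (m + k); pose e1 := ones R m; pose e2 := ones R k.
have eE : e = col_mx e1 e2 by rewrite col_mx_const.
have i1 := Ordinal hm; have i2 := Ordinal hk.
have PE := submxK P; set A := ulsubmx P in PE; set B := ursubmx P in PE.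
set C := dlsubmx P in PE; set D := drsubmx P in PE.
(* A kernel vector of [1%:M - D], extended by zero, is harmonic on its support; [Au] is
   symmetric. *)
have Du : 1%:M - D \in unitmx.
  apply: unitmx_inj => y; rewrite mulmxBl mul1mx => /eqP; rewrite subr_eq0 => /eqP yD.
  suff /eqP : col_mx (0 : 'cV_m) y = 0 by rewrite col_mx_eq0 => /andP[_ /eqP].
  apply: (harmonic_on_support_eq0 (j := lshift k i1) hPs hPi) => [|i].
    by rewrite col_mxEu mxE.
  rewrite -PE mul_block_col !mulmx0 !add0r -yD.
  case: (split_ordP i) => j ->; first by rewrite !col_mxEu mxE eqxx.
  by rewrite !col_mxEd.
have Au : 1%:M - A \in unitmx.
  apply: unitmx_inj => y; rewrite mulmxBl mul1mx => /eqP; rewrite subr_eq0 => /eqP yA.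
  suff /eqP : col_mx y (0 : 'cV_k) = 0 by rewrite col_mx_eq0 => /andP[/eqP].
  apply: (harmonic_on_support_eq0 (j := rshift m i2) hPs hPi) => [|i].
    by rewrite col_mxEd mxE.
  rewrite -PE mul_block_col !mulmx0 !addr0 -yA.
  case: (split_ordP i) => j ->; last by rewrite !col_mxEd mxE eqxx.
  by rewrite !col_mxEu.
(* A kernel vector [x] of [M] has [pi^T *m x = 0], so it is harmonic, hence constant, and its
   [pi]-average 0 is that constant. *)
have Mu : M \in unitmx.
  apply: unitmx_inj => x Mx.
  have pix : pi^T *m x = 0.
    rewrite -[RHS](mulmx0 _ pi^T) -Mx mulmxA mulmxDr mulmxBr mulmx1 piP subrr add0r.
    by rewrite mulmxA pie mul1mx.
  move: Mx; rewrite mulmxDl -mulmxA pix mulmx0 addr0 mulmxBl mul1mx.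
  move/eqP; rewrite subr_eq0 => /eqP xP.
  have xc := subharmonic_const hPs hPi (x := x).
  have {}xc : forall i j, x i 0 = x j 0 by apply: xc => i; rewrite -xP.
  have xE : x = x (lshift k i1) 0 *: e.
    by apply/colP=> i; rewrite !mxE mulr1.
  move: pix; rewrite xE -scalemxAr pie => /matrixP/(_ 0 0).
  by rewrite !mxE eqxx mulr1 => ->; rewrite scale0r.
have MZ : M *m Z = 1%:M := mulmxV Mu.
have piM : pi^T *m M = pi^T.
  by rewrite mulmxDr mulmxBr mulmx1 piP subrr add0r mulmxA pie mul1mx.
have piZ : pi^T *m Z = pi^T by rewrite -{1}piM mulmxK.
have Ze : Z *m e = e.
  have Me : M *m e = e.
    by rewrite mulmxDl mulmxBl mul1mx Pe subrr add0r -mulmxA pie mulmx1.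
  by rewrite -{1}Me mulKmx.
have kP : kemeny P = real_complex R (\tr Z - 1) := kemeny_trace Pe pie MZ.
pose Z1 := ulsubmx Z; pose Z2 := ursubmx Z.
pose Z3 := dlsubmx Z; pose Z4 := drsubmx Z.
have ZE : Z = block_mx Z1 Z2 Z3 Z4 by rewrite submxK.
pose v1 := pi1^T; pose v2 := (dsubmx pi)^T.
have piE : pi^T = row_mx v1 v2 by rewrite -tr_col_mx vsubmxK.
have [ABe CDe] : A *m e1 + B *m e2 = e1 /\ C *m e1 + D *m e2 = e2.
  by apply: eq_col_mx; rewrite -mul_block_col PE -eE.
(* The blocks of [(1%:M - P) *m Z = 1%:M - e *m pi^T], paired by columns of [Z]: [AZ1] and [AZ3]
   serve the first complement, [AZ4] and [AZ2] the second. *)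
have [AZ1 AZ2 AZ3 AZ4] :
  [/\ (1%:M - A) *m Z1 - B *m Z3 = 1%:M - e1 *m v1,
      (1%:M - A) *m Z2 - B *m Z4 = - (e1 *m v2),
      (1%:M - D) *m Z3 - C *m Z1 = - (e2 *m v1) &
      (1%:M - D) *m Z4 - C *m Z2 = 1%:M - e2 *m v2].
  have : (1%:M - P) *m Z = 1%:M - e *m pi^T.
    by rewrite -[X in _ = X - _]MZ [in RHS]mulmxDl -mulmxA piZ addrK.
  rewrite -PE ZE eE piE mul_col_row !scalar_mx_block opp_block_mx add_block_mx.
  rewrite opp_block_mx add_block_mx mulmx_block !sub0r !mulNmx.
  case/eq_block_mx => E1 E2 E3 E4.
  by split=> //; rewrite addrC.
have pi0 i : 0 < pi i 0 := stationary_gt0 i hPs hPi hpi.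
have v10 i : 0 < v1 0 i by rewrite !mxE.
have v20 i : 0 < v2 0 i by rewrite !mxE.
pose p := (v1 *m e1) 0 0; pose q := (v2 *m e2) 0 0.
have p0 : 0 < p.
  rewrite /p mxE (bigD1 i1) //= ltr_wpDr ?mxE ?mulr1 // sumr_ge0 // => j _.
  by rewrite [e1 j 0]mxE mulr1 ltW.
have q0 : 0 < q.
  rewrite /q mxE (bigD1 i2) //= ltr_wpDr ?mxE ?mulr1 // sumr_ge0 // => j _.
  by rewrite [e2 j 0]mxE mulr1 ltW.
have k1 := kemeny_schur_complement ABe CDe Du AZ1 AZ3 (lt0r_neq0 p0).
(* The same formula with the two index blocks exchanged. *)
have k2 := kemeny_schur_complement (etrans (addrC _ _) CDe)
  (etrans (addrC _ _) ABe) Au AZ4 AZ2 (lt0r_neq0 q0).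
rewrite kP (k1 : kemeny (stoch_compl1 P) = _) (k2 : kemeny (stoch_compl2 P) = _).
rewrite -/p -/q; set a := (_ *m _) 0 0; set b := (v2 *m _ *m _) 0 0.
pose x := (v1 *m Z2 *m e2) 0 0; pose y := (v2 *m Z3 *m e1) 0 0.
have [Ze1 Ze2] : Z1 *m e1 + Z2 *m e2 = e1 /\ Z3 *m e1 + Z4 *m e2 = e2.
  by apply: eq_col_mx; rewrite -mul_block_col -ZE -eE.
have [vZ1 vZ2] : v1 *m Z1 + v2 *m Z3 = v1 /\ v1 *m Z2 + v2 *m Z4 = v2.
  by apply: eq_row_mx; rewrite -mul_row_block -ZE -piE.
have ax : a + x = p by rewrite /a /x -!mulmxA /p -[in RHS]Ze1 mulmxDr [RHS]mxE.
have bx : b + x = q.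
  by rewrite addrC /b /x /q -[in RHS]vZ2 mulmxDl [RHS]mxE.
have ay : a + y = p by rewrite /a /y /p -[in RHS]vZ1 mulmxDl [RHS]mxE.
(* Row sums of [Z] give [a + x = p] and its left fixed vector gives [a + y = p], so one [x] serves
   both rows of the coupling matrix. *)
have yx : y = x by apply: (addrI a); rewrite ax.
have row1 i : \sum_j `|Z1 i j| + \sum_j `|Z2 i j| <= z.
  apply: le_trans (le_mx_norm_inf Z (lshift k i)).
  by rewrite big_split_ord /=; apply: lerD; apply: ler_sum => j _; rewrite !mxE.
have row2 i : \sum_j `|Z3 i j| + \sum_j `|Z4 i j| <= z.
  apply: le_trans (le_mx_norm_inf Z (rshift m i)).
  by rewrite big_split_ord /=; apply: lerD; apply: ler_sum => j _; rewrite !mxE.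
have n1 := ler_norm_weighted_rows (fun i => ltW (v10 i)) row1.
have n2 := ler_norm_weighted_rows (fun i => ltW (v20 i)) row2.
rewrite -/a -/x -/p -/y -/b -/q yx in n1 n2.
have gz := coupling_eigenvalue_bound p0 q0 ax bx n1 n2.
have z0 : 0 <= z := le_trans (normr_ge0 _) gz.
have -> : \tr Z = \tr Z1 + \tr Z4 by rewrite ZE mxtrace_block.
rewrite -!rmorphB.
have -> : \tr Z1 + \tr Z4 - 1 - (\tr Z1 - a / p) - (\tr Z4 - b / q)
    = a / p + b / q - 1 by ring.
(* The argument is now the image of a real number, so its complex modulus is an absolute value. *)
rewrite normc_def /= expr0n addr0 sqrtr_sqr lecR; apply: le_trans gz _.
set w := vec_norm1 _; rewrite mulrAC -[X in X <= _]mul1r ler_wpM2r //.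
have : w <= Num.max w (1 - w) by rewrite le_max lexx.
have : 1 - w <= Num.max w (1 - w) by rewrite le_max lexx orbT.
by lra.
Qed.
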